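(* Let $Q=\{Q_0(x),\dots,Q_{n-1}(x)\}$, $\deg Q_k=k$, be a system of well-free polynomials satisfying $$Q_k(x)=(\alpha_kx-\delta_k)Q_{k-1}(x)-(\beta_kx+\gamma_k)Q_{k-2}(x),\qquad k=1,\dots,n-1,$$ where for $k=1$ the last term is absent, i.e. $Q_1(x)=(\alpha_1x-\delta_1)Q_0(x)$, and put $\alpha_0=1$, $\beta_1=0$. Then the recurrence relation matrices $M_Q$, $N_Q$ have the following form. $M_Q$ is unit upper triangular, its $(k,k+1)$ entry is $\delta_k+\frac{\beta_k}{\alpha_{k-1}}$ for $k=1,\dots,n-1$, and its $(j+1,k+1)$ entry for $0\le j$, $j+2\le k\le n-1$ is $$a_{jk}=\frac{\alpha_k}{\alpha_{j+2}}\left(\left(\frac{\delta_{j+1}}{\alpha_{j+1}}+\frac{\beta_{j+1}}{\alpha_j\alpha_{j+1}}\right)\beta_{j+2}+\gamma_{j+2}\right)\cdot\left(\frac{\beta}{\alpha}\right)^{\times}_{j+1,k},\qquad\left(\frac{\beta}{\alpha}\right)^{\times}_{j+1,k}=\prod_{i=j+2}^{k-1}\frac{\beta_{i+1}}{\alpha_{i+1}} .$$ $N_Q$ has $(k,k+1)$ entry $\alpha_k$ for $k=1,\dots,n-1$ and all other entries zero.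
   Context: Empty products equal $1$. For a system of complex polynomials $Q_0,\dots,Q_{n-1}$ with $\deg Q_k=k$, written as $$Q_0(x)=\tau_0,\qquad Q_k(x)=\tau_kx\,Q_{k-1}(x)-a_{k-1,k}Q_{k-1}(x)-a_{k-2,k}Q_{k-2}(x)-\cdots-a_{0,k}Q_0(x),$$ the recurrence relation matrices are the $n\times n$ matrices: $M_Q$, unit upper triangular with $(j+1,k+1)$ entry $a_{j,k}$ for $0\le j<k\le n-1$; and $N_Q$, with $(k,k+1)$ entry $\tau_k$ for $k=1,\dots,n-1$ and zeros elsewhere. *)

(* Defs.v *)
From mathcomp Require Import all_boot all_order all_algebra.
From mathcomp Require Import reals.
From mathcomp Require Import complex.

Set Implicit Arguments.
Unset Strict Implicit.
Unset Printing Implicit Defensive.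
Import Order.TTheory GRing.Theory Num.Theory.
Local Open Scope ring_scope.

(* A system Q_0, ..., Q_{n-1} is a sequence indexed by nat of which only the
   terms of index < n are constrained.  Matrices are indexed from 0, so the
   (j+1,k+1) entry of the text is the entry (j,k) here. *)

Definition degree_graded (C : fieldType) (n : nat) (Q : nat -> {poly C}) :=
  forall k, (k < n)%N -> size (Q k) = k.+1.

Definition recurrence_coefficients (C : fieldType) (n : nat)
    (Q : nat -> {poly C}) (tau : nat -> C) (a : nat -> nat -> C) :=
  Q 0%N = (tau 0%N)%:P /\
  forall k, (1 <= k < n)%N ->
    Q k = tau k *: ('X * Q k.-1) - \sum_(0 <= j < k) a j k *: Q j.

Definition M_of (C : fieldType) (n : nat) (a : nat -> nat -> C) : 'M[C]_n :=
  \matrix_(j < n, k < n)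
    if (j < k)%N then a j k else if (j == k :> nat) then 1 else 0.

Definition N_of (C : fieldType) (n : nat) (tau : nat -> C) : 'M[C]_n :=
  \matrix_(j < n, k < n) if (k == j.+1 :> nat) then tau k else 0.

Definition recurrence_matrices (C : fieldType) (n : nat)
    (Q : nat -> {poly C}) (M N : 'M[C]_n) :=
  exists (tau : nat -> C) (a : nat -> nat -> C),
    [/\ recurrence_coefficients n Q tau a, M = M_of n a & N = N_of n tau].

(* Together with degree_graded, which forces alpha k != 0 for 1 <= k < n,
   this recurrence is what makes the system well-free. *)
Definition well_free_recurrence (C : fieldType) (n : nat)
    (Q : nat -> {poly C}) (alpha beta gamma delta : nat -> C) :=
  ((1 < n)%N -> Q 1%N = (alpha 1%N *: 'X - (delta 1%N)%:P) * Q 0%N) /\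
  forall k, (2 <= k < n)%N ->
    Q k = (alpha k *: 'X - (delta k)%:P) * Q k.-1
          - (beta k *: 'X + (gamma k)%:P) * Q k.-2.

(* (beta/alpha)^x_{l,k}: the product over l+1 <= i <= k-1. *)
Definition ratio_prod (C : fieldType) (beta alpha : nat -> C) (l k : nat) : C :=
  \prod_(l.+1 <= i < k) (beta i.+1 / alpha i.+1).

(* Main.v *)
Require Import Defs.
From mathcomp Require Import all_boot all_order all_algebra.
From mathcomp Require Import reals.
From mathcomp Require Import complex.
From mathcomp Require Import ring zify.

(** The polynomials [Q 0, ..., Q n.-1] have pairwise distinct degrees, so they
are linearly independent and the pair (M, N) of recurrence relation matrices of
[Q] is unique ([recurrence_coefficients_uniq]): [tau k] is read off the
coefficient of degree [k], then the [a j k] off the remaining linear relation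
among the [Q j].  It therefore suffices to exhibit one expansion of the required
shape.

The only terms of the well-free recurrence that are not already of that shape
are the [beta k *: ('X * Q k.-2)].  The expansion of [Q k.-1] can be solved for
['X * Q k.-2], because [alpha k.-1 != 0]; substituting it turns column [k.-1]
of M, its diagonal entry 1 included, into column [k], after multiplication by
[beta k / alpha k.-1], with [delta k] and [gamma k] added to the two entries
just above the diagonal.  The closed form of the statement solves this recursion
from column to column ([wf_coef_rec], [wf_coef_superdiag2]): above the second
superdiagonal each step contributes one factor [beta k / alpha k.-1], and the
product of these factors telescopes in the [alpha]s. *)

Set Implicit Arguments.
Unset Strict Implicit.
Unset Printing Implicit Defensive.
Import Order.TTheory GRing.Theory Num.Theory.
Local Open Scope ring_scope.

(** * Degree-graded systems and uniqueness of the expansion *)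

Lemma degree_graded_coef_gt (C : fieldType) n (Q : nat -> {poly C}) j i :
  degree_graded n Q -> (j < n)%N -> (j < i)%N -> (Q j)`_i = 0.
Proof. by move=> hdeg ltjn ltji; rewrite nth_default ?hdeg. Qed.

Lemma degree_graded_coef_neq0 (C : fieldType) n (Q : nat -> {poly C}) k :
  degree_graded n Q -> (k < n)%N -> (Q k)`_k != 0.
Proof.
move=> hdeg ltkn; have := lead_coef_eq0 (Q k).
by rewrite lead_coefE hdeg //= -size_poly_eq0 hdeg // => ->.
Qed.

(** Looking at the coefficient of highest degree [m.-1] kills the last scalar;
the others follow by induction. *)
Lemma degree_graded_free (C : fieldType) n (Q : nat -> {poly C})
    (c : nat -> C) m :
  degree_graded n Q -> (m <= n)%N ->
  \sum_(0 <= j < m) c j *: Q j = 0 -> forall j, (j < m)%N -> c j = 0.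
Proof.
move=> hdeg; elim: m => [|m IHm] // ltmn sum0.
have cm0 : c m = 0.
  have /(congr1 (coefp m)) := sum0.
  rewrite /= big_nat_recr //= coefD coef_sum coefZ coef0 big_nat big1 => [|j].
    by move/eqP; rewrite add0r mulf_eq0 (negPf (degree_graded_coef_neq0 hdeg _))
      // orbF => /eqP.
  move=> /andP[_ ltjm].
  by rewrite coefZ (degree_graded_coef_gt hdeg) ?mulr0 // (ltn_trans ltjm).
move: sum0; rewrite big_nat_recr //= cm0 scale0r addr0 => sum0 j.
rewrite ltnS leq_eqVlt => /orP[/eqP-> //|]; exact: IHm (ltnW ltmn) sum0 j.
Qed.

Lemma recurrence_coefficients_uniq (C : fieldType) n (Q : nat -> {poly C})
    (tau tau' : nat -> C) (a a' : nat -> nat -> C) :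
  degree_graded n Q ->
  recurrence_coefficients n Q tau a -> recurrence_coefficients n Q tau' a' ->
  forall k, (1 <= k < n)%N ->
    tau k = tau' k /\ forall j, (j < k)%N -> a j k = a' j k.
Proof.
move=> hdeg [_ recQ] [_ recQ'] k kn; have /andP[k_gt0 ltkn] := kn.
have ltk1n : (k.-1 < n)%N by lia.
have topcoef (t : C) (b : nat -> nat -> C) :
    Q k = t *: ('X * Q k.-1) - \sum_(0 <= j < k) b j k *: Q j ->
    (Q k)`_k = t * (Q k.-1)`_k.-1.
  move/(congr1 (coefp k)); rewrite /= coefB coefZ coefXM coef_sum.
  rewrite (negPf (lt0n_neq0 k_gt0)) big_nat big1 ?subr0 // => j /andP[_ ltjk].
  by rewrite coefZ (degree_graded_coef_gt hdeg) ?mulr0 // (ltn_trans ltjk).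
have eq_tau : tau k = tau' k.
  apply: (mulIf (degree_graded_coef_neq0 hdeg ltk1n)).
  by rewrite -(topcoef _ _ (recQ k kn)) -(topcoef _ _ (recQ' k kn)).
split=> // j ltjk; apply/eqP; rewrite -subr_eq0; apply/eqP.
apply: (degree_graded_free (c := fun j => a j k - a' j k) hdeg (ltnW ltkn)) => //.
under eq_bigr do rewrite scalerBl.
rewrite sumrB; apply/eqP; rewrite subr_eq0; apply/eqP.
apply: oppr_inj; apply: (addrI (tau k *: ('X * Q k.-1))).
by rewrite -(recQ k kn) eq_tau -(recQ' k kn).
Qed.

Lemma recurrence_matrices_uniq (C : fieldType) n (Q : nat -> {poly C})
    (tau : nat -> C) (a : nat -> nat -> C) (M N : 'M[C]_n) :
  degree_graded n Q -> recurrence_coefficients n Q tau a ->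
  recurrence_matrices Q M N <-> M = M_of n a /\ N = N_of n tau.
Proof.
move=> hdeg hQ; split=> [[tau' [a' [hQ' -> ->]]]|[-> ->]]; last by exists tau, a.
have uniq := recurrence_coefficients_uniq hdeg hQ' hQ.
split; apply/matrixP => j k; rewrite !mxE; case: ifP => //.
  move=> ltjk; have kn : (1 <= k < n)%N by rewrite ltn_ord andbT; lia.
  by have [_ ->] := uniq _ kn.
move=> /eqP kE; have kn : (1 <= k < n)%N by rewrite ltn_ord andbT kE.
by have [->] := uniq _ kn.
Qed.

(** * The expansion of a well-free system *)

(** Otherwise every term of the recurrence for [Q k] has degree less than [k]. *)
Lemma well_free_alpha_neq0 (C : fieldType) n (Q : nat -> {poly C})
    (alpha beta gamma delta : nat -> C) :
  degree_graded n Q -> well_free_recurrence n Q alpha beta gamma delta ->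
  forall k, (1 <= k < n)%N -> alpha k != 0.
Proof.
move=> hdeg [rec1 rec2] [|[|k]] // /andP[_ ltkn]; apply/eqP => alpha0.
  have /eqP[] := degree_graded_coef_neq0 hdeg ltkn.
  rewrite rec1 // alpha0 scale0r sub0r mulNr coefN coefCM.
  by rewrite (degree_graded_coef_gt hdeg) ?mulr0 ?oppr0 // ltnW.
have /eqP[] := degree_graded_coef_neq0 hdeg ltkn.
rewrite rec2 // alpha0 scale0r sub0r mulNr mulrDl -scalerAl.
rewrite coefB coefN coefCM coefD coefCM coefZ coefXM /=.
by rewrite !(degree_graded_coef_gt hdeg) ?(mulr0, addr0, oppr0) //; lia.
Qed.

Definition wf_coef (C : fieldType) (alpha beta gamma delta : nat -> C)
    (j k : nat) : C :=
  if k == j.+1 then delta k + beta k / alpha k.-1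
  else alpha k / alpha (j + 2)%N
       * ((delta (j + 1)%N / alpha (j + 1)%N
           + beta (j + 1)%N / (alpha j * alpha (j + 1)%N))
            * beta (j + 2)%N
          + gamma (j + 2)%N)
       * ratio_prod beta alpha (j + 1) k.

(** Here the product of ratios gains the factor [beta k.+1 / alpha k.+1], whose
denominator is cancelled by the leading [alpha k.+1], while [alpha k] is divided
out. *)
Lemma wf_coef_rec (C : fieldType) (alpha beta gamma delta : nat -> C) j k :
  alpha k != 0 -> alpha k.+1 != 0 -> (j.+1 < k)%N ->
  wf_coef alpha beta gamma delta j k.+1
  = beta k.+1 / alpha k * wf_coef alpha beta gamma delta j k.
Proof.
move=> ak ak1 ltjk; rewrite /wf_coef !gtn_eqF //; last by lia.
rewrite /ratio_prod big_nat_recr /=; last by lia.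
set P := \prod_(_ <= _ < _) _; set T := _ + gamma _; set u := (alpha (j + 2))^-1.
by field; rewrite ak ak1.
Qed.

Lemma wf_coef_superdiag2 (C : fieldType) (alpha beta gamma delta : nat -> C) k :
  alpha k.+1 != 0 -> alpha k.+2 != 0 ->
  wf_coef alpha beta gamma delta k k.+2
  = gamma k.+2
    + beta k.+2 / alpha k.+1 * wf_coef alpha beta gamma delta k k.+1.
Proof.
move=> ak1 ak2; rewrite /wf_coef eqxx gtn_eqF // /ratio_prod addn1 addn2.
rewrite big_geq // mulr1 divff //= mul1r invfM; ring.
Qed.

(** Induction on [k] by the substitution described above.  For [k = 1] there is no
earlier column, and [beta 1 = 0] makes the closed form reduce to [delta 1]. *)
Lemma well_free_recurrence_coefficients (C : fieldType) n
    (Q : nat -> {poly C}) (alpha beta gamma delta : nat -> C) :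
  (0 < n)%N -> degree_graded n Q ->
  well_free_recurrence n Q alpha beta gamma delta -> beta 1%N = 0 ->
  (* [tau 0] is the constant [Q 0], to which [alpha 0] is unrelated *)
  recurrence_coefficients n Q
    (fun k => if k == 0%N then (Q 0%N)`_0 else alpha k)
    (wf_coef alpha beta gamma delta).
Proof.
move=> n_gt0 hdeg hrec beta1.
have alpha_neq0 := well_free_alpha_neq0 hdeg hrec.
have [rec1 rec2] := hrec.
split=> [|k]; first by apply: size1_polyC; rewrite hdeg.
set A := wf_coef alpha beta gamma delta.
elim: k => // -[_ /= lt1n|k IHk /= ltkn].
  rewrite rec1 // big_nat1 /A /wf_coef eqxx beta1 mul0r addr0.
  by rewrite mulrBl -scalerAl mul_polyC.
have ak1 : alpha k.+1 != 0 by rewrite alpha_neq0 //= ltnW.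
have ak2 : alpha k.+2 != 0 by rewrite alpha_neq0.
set r := beta k.+2 / alpha k.+1.
have XQ : beta k.+2 *: ('X * Q k)
    = r *: Q k.+1 + r *: (\sum_(0 <= j < k.+1) A j k.+1 *: Q j).
  have /= -> := IHk (ltnW ltkn).
  by rewrite -scalerDr subrK scalerA divfK.
rewrite rec2 //= mulrBl mulrDl -!scalerAl !mul_polyC XQ.
rewrite (big_nat_recr k.+1) // !(big_nat_recr k) //=.
have -> : \sum_(0 <= j < k) A j k.+2 *: Q j
    = r *: (\sum_(0 <= j < k) A j k.+1 *: Q j).
  rewrite scaler_sumr big_nat [RHS]big_nat; apply: eq_bigr => j /andP[_ ltjk].
  by rewrite scalerA /A wf_coef_rec.
have -> : A k k.+2 = gamma k.+2 + r * A k k.+1 by exact: wf_coef_superdiag2.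
have -> : A k.+1 k.+2 = delta k.+2 + r by rewrite /A /wf_coef eqxx.
rewrite scalerDr scalerA !scalerDl -!mul_polyC; ring.
Qed.

Theorem lemma3p5 (R : realType) (n : nat) (hn : (0 < n)%N)
    (Q : nat -> {poly (complex R)})
    (alpha beta gamma delta : nat -> complex R)
    (hdeg : degree_graded n Q)
    (hrec : well_free_recurrence n Q alpha beta gamma delta)
    (halpha0 : alpha 0%N = 1) (hbeta1 : beta 1%N = 0)
    (M N : 'M[complex R]_n) :
  recurrence_matrices Q M N <->
  [/\ (* M is unit upper triangular *)
      (forall j : 'I_n, M j j = 1) /\
        (forall j k : 'I_n, (k < j)%N -> M j k = 0),
      forall j k : 'I_n, (k = j.+1 :> nat) ->
        M j k = delta k + beta k / alpha k.-1,
      forall j k : 'I_n, (j + 2 <= k)%N ->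
        M j k =
          alpha k / alpha (j + 2)%N
          * ((delta (j + 1)%N / alpha (j + 1)%N
              + beta (j + 1)%N / (alpha j * alpha (j + 1)%N))
               * beta (j + 2)%N
             + gamma (j + 2)%N)
          * ratio_prod beta alpha (j + 1) k
    & forall j k : 'I_n,
        N j k = if (k == j.+1 :> nat) then alpha k else 0].
Proof.
have hQ := well_free_recurrence_coefficients hn hdeg hrec hbeta1.
rewrite (recurrence_matrices_uniq M N hdeg hQ).
split=> [[-> ->]|[[Mdiag Mlow] Msup Mup Nent]].
  split; first split.
  - by move=> j; rewrite mxE ltnn eqxx.
  - by move=> j k ltkj; rewrite mxE ltnNge (ltnW ltkj) gtn_eqF.
  - by move=> j k kE; rewrite mxE kE ltnSn /wf_coef eqxx.
  - move=> j k lejk; rewrite mxE /wf_coef gtn_eqF; last by lia.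
    by rewrite ifT //; lia.
  - by move=> j k; rewrite mxE; case: eqP => // ->.
split; apply/matrixP => j k; rewrite mxE.
  case: ltngtP => [ltjk|ltkj|/ord_inj <-]; [|exact: Mlow|exact: Mdiag].
  rewrite /wf_coef; case: eqP => [kE|neq]; first exact: Msup.
  by apply: Mup; lia.
by rewrite Nent; case: eqP => // ->.
Qed.
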